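(* Suppose $\sigma$ occurs at least twice as a consecutive pattern in $\tau$, that $|\tau|-|\sigma|\ge 3$, and that $\partial\tau\partial$ lies in $[\sigma,\tau]$. If $[\sigma,\tau]$ has no carrier element, then $\mu(\sigma,\tau)=0$. Otherwise, $\mu(\sigma,\tau)=\mu(\sigma,\xi)$, where $\xi$ is the carrier element of $[\sigma,\tau]$.
   Context: Permutations are of $[d]=\{1,\dots,d\}$; $|\pi|$ is the length of $\pi$. The standard form of a sequence of distinct integers is the permutation order isomorphic to it. An occurrence of a consecutive pattern $\sigma$ in $\tau$ is a factor of consecutive letters of $\tau$ order isomorphic to $\sigma$. Permutations are partially ordered by $\sigma\le\tau$ iff $\sigma$ occurs as a consecutive pattern in $\tau$ ($<$ means $\le$ and $\ne$); $[\sigma,\tau]=\{\rho:\sigma\le\rho\le\tau\}$, and $\mu$ is the Möbius function of this poset ($\mu(x,x)=1$, $\mu(x,y)=-\sum_{x\le z<y}\mu(x,z)$ for $x<y$, $\mu(x,y)=0$ if $x\not\le y$). For $\tau$: $\partial\tau$, $\tau\partial$, $\partial\tau\partial$ denote the standard forms of $\tau$ with, respectively, its first letter, its last letter, and both its first and last letters removed. A carrier element of $[\sigma,\tau]$ is an element $\xi\in[\sigma,\tau]$ with $\xi<\partial\tau$, $\xi<\tau\partial$ and $\xi\not\le\partial\tau\partial$; there is at most one such element. *)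

(* Defs.v *)
From HB Require Import structures.
From mathcomp Require Import all_boot all_order all_algebra zify.

Set Implicit Arguments.
Unset Strict Implicit.
Unset Printing Implicit Defensive.

Import Order.TTheory GRing.Theory.

Definition is_permutation (s : seq nat) : bool := perm_eq s (iota 1 (size s)).

(* Permutations of [d] = {1, ..., d}, d arbitrary, in one-line notation;
   the length |pi| is [size pi]. *)
Record permutation := Permutation {
  letters :> seq nat;
  _ : is_permutation letters }.

HB.instance Definition _ := [isSub for letters].
HB.instance Definition _ := [Countable of permutation by <:].

Definition order_iso (s t : seq nat) : bool :=
  (size s == size t) &&
  [forall i : 'I_(size s), forall j : 'I_(size s),
     (nth 0 s i < nth 0 s j) == (nth 0 t i < nth 0 t j)].

(* Each letter is replaced by its rank, counted from 1. *)
Definition std_word (s : seq nat) : seq nat :=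
  [seq count (fun y => y <= x) s | x <- s].

Definition factor (s : seq nat) (i k : nat) : seq nat := take k (drop i s).

Lemma order_isoP s t :
  reflect (size s = size t /\ forall i j, i < size s -> j < size s ->
             (nth 0 s i < nth 0 s j) = (nth 0 t i < nth 0 t j))
          (order_iso s t).
Proof.
apply: (iffP andP) => [[/eqP sz /forallP H]|[sz H]].
  split=> // i j Hi Hj.
  by have /forallP/(_ (Ordinal Hj))/eqP := H (Ordinal Hi).
by split; [apply/eqP | apply/forallP => i; apply/forallP => j; rewrite H].
Qed.

Lemma order_iso_refl s : order_iso s s.
Proof. by apply/order_isoP. Qed.

Lemma order_iso_sym s t : order_iso s t -> order_iso t s.
Proof.
by move=> /order_isoP[sz H]; apply/order_isoP; split=> // i j Hi Hj;
  rewrite H // sz.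
Qed.

Lemma order_iso_trans s t u : order_iso s t -> order_iso t u -> order_iso s u.
Proof.
move=> /order_isoP[sz H] /order_isoP[sz' H']; apply/order_isoP.
by split=> [|i j Hi Hj]; [rewrite sz | rewrite H // H' -?sz].
Qed.

Lemma order_iso_size s t : order_iso s t -> size s = size t.
Proof. by case/order_isoP. Qed.

Lemma rank_lt (s : seq nat) x y : y \in s ->
  (count (fun z => z <= x) s < count (fun z => z <= y) s) = (x < y).
Proof.
move=> ys; case: (ltnP x y) => xy; last first.
  by apply/negbTE; rewrite -leqNgt; apply: sub_count => z /= /leq_trans ->.
have -> : count (fun z => z <= y) s =
    count (fun z => z <= x) s + count (fun z => x < z <= y) s.
  by elim: s {ys} => //= z s ->; lia.
have : 0 < count (fun z => x < z <= y) s.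
  by rewrite -has_count; apply/hasP; exists y => //; rewrite xy leqnn.
lia.
Qed.

Lemma size_std_word s : size (std_word s) = size s.
Proof. exact: size_map. Qed.

Lemma std_word_iso s : order_iso s (std_word s).
Proof.
apply/order_isoP; split=> [|i j Hi Hj]; first by rewrite size_std_word.
by rewrite /std_word !(nth_map 0) // rank_lt // mem_nth.
Qed.

Lemma std_word_proof s : uniq s -> is_permutation (std_word s).
Proof.
move=> Us; rewrite /is_permutation size_std_word.
have Ustd : uniq (std_word s).
  rewrite map_inj_in_uniq // => x y xs ys E.
  have := rank_lt x ys; have := rank_lt y xs; rewrite E ltnn; lia.
have sub : {subset std_word s <= iota 1 (size s)}.
  move=> _ /mapP[x xs ->]; rewrite mem_iota add1n ltnS count_size andbT.
  by rewrite -has_count; apply/hasP; exists x.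
have [] := uniq_min_size Ustd sub; first by rewrite size_iota size_std_word.
by move=> _ E; apply: uniq_perm => //; apply: iota_uniq.
Qed.

Lemma std_word_permutation s : is_permutation s -> std_word s = s.
Proof.
move=> Ps; rewrite -[RHS]map_id; apply/eq_in_map => x xs /=.
rewrite (permP Ps).
have : x \in iota 1 (size s) by rewrite -(perm_mem Ps).
rewrite mem_iota => Hx.
have -> : size s = x + (size s - x) by lia.
rewrite iotaD count_cat.
have -> : count (fun y => y <= x) (iota 1 x) = x.
  rewrite -[RHS](size_iota 1 x); apply/eqP; rewrite -all_count.
  by apply/allP => y; rewrite mem_iota; lia.
rewrite (eq_in_count (a2 := pred0)) ?count_pred0 ?addn0 // => y.
by rewrite mem_iota /=; lia.
Qed.

Lemma order_iso_std s t : order_iso s t -> std_word s = std_word t.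
Proof.
move=> /order_isoP[sz H]; apply: (@eq_from_nth _ 0).
  by rewrite !size_std_word.
move=> i; rewrite size_std_word => Hi.
rewrite /std_word !(nth_map 0) -?sz //.
rewrite -{2}(mkseq_nth 0 s) -{2}(mkseq_nth 0 t) /mkseq !count_map -sz.
by apply: eq_in_count => j; rewrite mem_iota /= => Hj;
  rewrite leqNgt [RHS]leqNgt H; lia.
Qed.

Lemma order_iso_permutation (s t : permutation) : order_iso s t -> s = t.
Proof.
case: s t => [s Ps] [t Pt] /order_iso_std /= E; apply: val_inj => /=.
by rewrite -(std_word_permutation Ps) E std_word_permutation.
Qed.

Definition standard_form (s : seq nat) (Us : uniq s) : permutation :=
  Permutation (std_word_proof Us).

(* [standard_form] is the unique permutation order isomorphic to [s]. *)
Lemma standard_formP s (Us : uniq s) (p : permutation) :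
  order_iso p s <-> p = standard_form Us.
Proof.
split=> [H|->]; last exact/order_iso_sym/std_word_iso.
exact/order_iso_permutation/(order_iso_trans H)/std_word_iso.
Qed.

Lemma permutation_uniq (p : permutation) : uniq p.
Proof. by case: p => s Ps /=; rewrite (perm_uniq Ps) iota_uniq. Qed.

Lemma factor_uniq (p : permutation) i k : uniq (factor p i k).
Proof. exact/take_uniq/drop_uniq/permutation_uniq. Qed.

Lemma factor_iso s t i k :
  order_iso s t -> order_iso (factor s i k) (factor t i k).
Proof.
move=> /order_isoP[sz H]; apply/order_isoP.
split=> [|a b]; first by rewrite /factor !size_take_min !size_drop sz.
rewrite /factor size_take_min size_drop => Ha Hb.
by rewrite !nth_take ?nth_drop ?H //; lia.
Qed.

(* Occurrences are given by their starting position (counted from 0). Near the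
   end of [tau] a factor is shorter than [sigma], hence not an occurrence. *)
Definition occurrences (sigma tau : permutation) : {set 'I_(size tau).+1} :=
  [set i : 'I_(size tau).+1 | order_iso sigma (factor tau i (size sigma))].

Definition pattern_le (sigma tau : permutation) : bool :=
  occurrences sigma tau != set0.

Lemma pattern_leP (sigma tau : permutation) :
  reflect (exists i, order_iso sigma (factor tau i (size sigma)))
          (pattern_le sigma tau).
Proof.
apply: (iffP (set0Pn _)) => [[i]|[i Hi]]; first by rewrite inE; exists i.
have [lei|lti] := leqP i (size tau).
  by exists (Ordinal (n := (size tau).+1) lei); rewrite inE.
exists ord_max; rewrite inE /=; move: Hi.
by rewrite /factor drop_size drop_oversize // ltnW.
Qed.

Lemma pattern_le_size (sigma tau : permutation) :
  pattern_le sigma tau -> size sigma <= size tau.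
Proof.
move=> /pattern_leP[i /order_iso_size ->].
by rewrite /factor size_take_min size_drop; lia.
Qed.

Lemma pattern_le_refl : reflexive pattern_le.
Proof.
move=> p; apply/pattern_leP; exists 0.
by rewrite /factor drop0 take_size order_iso_refl.
Qed.

Lemma pattern_le_eq (p q : permutation) :
  pattern_le p q -> size p = size q -> p = q.
Proof.
move=> /pattern_leP[i Hi] sz; apply: order_iso_permutation.
have := order_iso_size Hi; rewrite /factor size_take_min size_drop => E.
have [p0|p0] := posnP (size p).
  by rewrite (size0nil p0) (size0nil (etrans (esym sz) p0)) order_iso_refl.
have i0 : i = 0 by lia.
by move: Hi; rewrite i0 /factor drop0 sz take_size.
Qed.

Lemma pattern_le_anti : antisymmetric pattern_le.
Proof.
move=> p q /andP[pq qp]; apply: pattern_le_eq => //.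
by apply/eqP; rewrite eqn_leq !pattern_le_size.
Qed.

Lemma pattern_le_trans : transitive pattern_le.
Proof.
move=> q p r /pattern_leP[i Hi] /pattern_leP[j Hj]; apply/pattern_leP.
have Hij := order_iso_trans Hi (factor_iso i (size p) Hj).
have [p0|p0] := posnP (size p).
  by exists 0; rewrite /factor p0 take0 (size0nil p0) order_iso_refl.
exists (i + j); move: Hij (order_iso_size Hi).
rewrite /factor -drop_drop size_take_min size_drop => Hij E.
move: Hij; have -> : size q = (size q - i) + i by lia.
by rewrite -take_drop take_takel //; lia.
Qed.

Fact pattern_display : Order.disp_t. Proof. exact: Order.Disp tt tt. Qed.

HB.instance Definition _ :=
  Order.Le_isPOrder.Build pattern_display permutation
    pattern_le_refl pattern_le_anti pattern_le_trans.

Lemma del_first_uniq (p : permutation) : uniq (behead p).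
Proof. by rewrite -drop1 drop_uniq // permutation_uniq. Qed.

Lemma del_last_uniq (p : permutation) : uniq (take (size p).-1 p).
Proof. by rewrite take_uniq // permutation_uniq. Qed.

Lemma del_both_uniq (p : permutation) :
  uniq (behead (take (size p).-1 p)).
Proof. by rewrite -drop1 drop_uniq // del_last_uniq. Qed.

Definition del_first (p : permutation) : permutation :=
  standard_form (del_first_uniq p).
Definition del_last (p : permutation) : permutation :=
  standard_form (del_last_uniq p).
Definition del_both (p : permutation) : permutation :=
  standard_form (del_both_uniq p).

(* All consecutive patterns of [tau], without repetition. *)
Definition patterns (tau : permutation) : seq permutation :=
  undup [seq standard_form (factor_uniq tau i k)
        | i <- iota 0 (size tau).+1, k <- iota 0 (size tau).+1].

Definition pattern_interval (sigma tau : permutation) : seq permutation :=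
  [seq rho <- patterns tau | (sigma <= rho <= tau)%O].

Lemma mem_patterns (rho tau : permutation) :
  (rho \in patterns tau) = (rho <= tau)%O.
Proof.
apply/idP/idP.
  rewrite mem_undup => /allpairsP[[i k] [_ _ ->]]; apply/pattern_leP; exists i.
  set f := factor tau i k; rewrite /= size_std_word.
  suff -> : factor tau i (size f) = f by apply/order_iso_sym/std_word_iso.
  rewrite /f /factor size_take; case: ltnP => // H.
  by rewrite take_size take_oversize.
move=> le; have /set0Pn[i] : pattern_le rho tau := le.
rewrite inE => Hi.
rewrite mem_undup; apply/allpairsP; exists (val i, size rho); split => /=.
- by rewrite (mem_iota 0 (size tau).+1) ltn_ord.
- by rewrite (mem_iota 0 (size tau).+1) ltnS pattern_le_size.
- exact/standard_formP.
Qed.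

Lemma mem_pattern_interval (sigma tau rho : permutation) :
  (rho \in pattern_interval sigma tau) = (sigma <= rho <= tau)%O.
Proof.
by rewrite mem_filter mem_patterns; case: (rho <= tau)%O; rewrite ?andbF ?andbT.
Qed.

Lemma pattern_interval_uniq (sigma tau : permutation) :
  uniq (pattern_interval sigma tau).
Proof. exact/filter_uniq/undup_uniq. Qed.

(* The first argument only bounds the recursion depth: chains below [tau] have
   length at most |tau|. The defining recursion of the Moebius function is
   [mobius_id], [mobius_lt] and [mobius_nle] below. *)
Fixpoint mobius_rec (n : nat) (sigma tau : permutation) : int :=
  if n is n'.+1 then
    if sigma == tau then 1%R
    else if (sigma <= tau)%O then
      (- \sum_(rho <- pattern_interval sigma tau | (rho < tau)%O)
           mobius_rec n' sigma rho)%R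
    else 0%R
  else 0%R.

Definition mobius (sigma tau : permutation) : int :=
  mobius_rec (size tau).+1 sigma tau.

Lemma pattern_lt_size (sigma tau : permutation) :
  (sigma < tau)%O -> size sigma < size tau.
Proof.
rewrite lt_neqAle => /andP[neq le].
rewrite ltn_neqAle pattern_le_size // andbT.
by apply: contraNneq neq => /(pattern_le_eq le) ->.
Qed.

Lemma mobius_rec_fuel n m (sigma tau : permutation) :
  size tau < n -> size tau < m ->
  mobius_rec n sigma tau = mobius_rec m sigma tau.
Proof.
elim: n m tau => [|n IH] [|m] tau //= Hn Hm.
case: eqP => // _; case: ifP => // _; congr (- _)%R.
apply: eq_bigr => rho /pattern_lt_size lt.
by apply: IH; apply: leq_trans lt _.
Qed.

Lemma mobius_id (sigma : permutation) : mobius sigma sigma = 1%R.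
Proof. by rewrite /mobius /= eqxx. Qed.

Lemma mobius_lt (sigma tau : permutation) : (sigma < tau)%O ->
  mobius sigma tau =
    (- \sum_(rho <- pattern_interval sigma tau | (rho < tau)%O)
         mobius sigma rho)%R.
Proof.
move=> lt; rewrite {1}/mobius /= lt_eqF // ltW //; congr (- _)%R.
by apply: eq_bigr => rho /pattern_lt_size ?; apply: mobius_rec_fuel.
Qed.

Lemma mobius_nle (sigma tau : permutation) : ~~ (sigma <= tau)%O ->
  mobius sigma tau = 0%R.
Proof.
move=> nle; rewrite /mobius /= (negbTE nle).
by case: eqP nle => // ->; rewrite lexx.
Qed.

Definition carrier (sigma tau xi : permutation) : bool :=
  [&& xi \in pattern_interval sigma tau,
      (xi < del_first tau)%O,
      (xi < del_last tau)%O &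
      ~~ (xi <= del_both tau)%O].

(* Main.v *)
(** Every element strictly below [tau] lies below [del_first tau] or
    [del_last tau], and the elements below both are those below [del_both tau]
    together with the carrier, if any (when the two deletions differ).  The
    Moebius function sums to [0] over the three intervals from [sigma] to
    [del_first tau], [del_last tau] and [del_both tau], so inclusion-exclusion
    leaves only the value at the carrier.  When the two deletions coincide there
    is no carrier and the sum below [tau] is a single vanishing one.  A carrier
    occurs in [tau] exactly as a proper prefix and a proper suffix; the longer
    of two carriers would carry an inner occurrence of the shorter one, which
    gives uniqueness. *)
Require Import Defs.
From mathcomp Require Import all_boot all_order all_algebra zify.

Set Implicit Arguments.
Unset Strict Implicit.
Unset Printing Implicit Defensive.

Import Order.TTheory GRing.Theory.

(** * Occurrences at a given position *)

Definition occurs_at (s : seq nat) (p : permutation) (i : nat) : bool :=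
  (i + size p <= size s) && order_iso p (factor s i (size p)).

Lemma occurs_at_iso s t p i : order_iso s t -> occurs_at s p i = occurs_at t p i.
Proof.
move=> st; rewrite /occurs_at (order_iso_size st); congr (_ && _).
apply/idP/idP => /order_iso_trans; apply; apply: factor_iso => //.
exact: order_iso_sym.
Qed.

Lemma occurs_at_behead s p i :
  0 < size s -> occurs_at (behead s) p i = occurs_at s p i.+1.
Proof. by case: s. Qed.

Lemma occurs_at_take n s p i :
  n <= size s ->
  occurs_at (take n s) p i = (i + size p <= n) && occurs_at s p i.
Proof.
move=> le_n; rewrite /occurs_at size_takel //.
case: leqP => //= le_i; rewrite (leq_trans le_i le_n) /=.
have -> : n = (n - i) + i by lia.
by rewrite /factor -take_drop take_takel //; lia.
Qed.

Lemma occurs_at_factor s p q i j :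
  occurs_at s q j -> occurs_at q p i -> occurs_at s p (j + i).
Proof.
move=> /andP[le_j iso_q]; rewrite (occurs_at_iso p i iso_q).
rewrite /occurs_at /factor size_takel ?size_drop; last by lia.
move=> /andP[le_i]; have -> : j + i + size p <= size s by lia.
have {1}-> : size q = (size q - i) + i by lia.
by rewrite -take_drop take_takel ?drop_drop 1?addnC //; lia.
Qed.

(** An occurrence of [p] lying within a copy of [q] belongs to [q] itself, so it recurs at the same
    offset in every other copy of [q]. *)
Lemma occurs_at_inside s p q i j k :
  occurs_at s q j -> occurs_at s p (j + i) -> i + size p <= size q ->
  occurs_at s q k -> occurs_at s p (k + i).
Proof.
move=> qj /andP[_ pij] le_i qk; apply: (occurs_at_factor qk).
case/andP: qj => le_j iso_q; rewrite (occurs_at_iso p i iso_q).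
rewrite /occurs_at /factor size_takel ?size_drop ?le_i /=; last by lia.
move: pij; rewrite /factor; have {1}-> : size q = (size q - i) + i by lia.
by rewrite -take_drop take_takel ?drop_drop 1?[i + j]addnC //; lia.
Qed.

Lemma occurs_at_inj s p q i :
  occurs_at s p i -> occurs_at s q i -> size p = size q -> p = q.
Proof.
move=> /andP[_ pi] /andP[_ qi] sz; apply: order_iso_permutation.
by apply: (order_iso_trans pi); rewrite sz; apply: order_iso_sym.
Qed.

Lemma pattern_occursP (p q : permutation) :
  reflect (exists i, occurs_at q p i) (p <= q)%O.
Proof.
apply: (iffP (pattern_leP p q)) => [[i iso]|[i /andP[_ iso]]]; last by exists i.
(* The empty pattern matches even past the end of [q], so position 0 replaces [i]. *)
have [p0|p0] := posnP (size p).
  by exists 0; rewrite /occurs_at /factor p0 take0 (size0nil p0) order_iso_refl.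
exists i; rewrite /occurs_at iso andbT.
by move: (order_iso_size iso); rewrite /factor size_take_min size_drop; lia.
Qed.

(** * Deleting end letters, and carriers *)

Section Deletions.

Variable tau : permutation.

Lemma occurs_at_del_first p i :
  0 < size tau -> occurs_at (del_first tau) p i = occurs_at tau p i.+1.
Proof.
move=> tau0; rewrite -occurs_at_behead //.
exact/occurs_at_iso/order_iso_sym/std_word_iso.
Qed.

Lemma occurs_at_del_last p i :
  occurs_at (del_last tau) p i =
    (i + size p <= (size tau).-1) && occurs_at tau p i.
Proof.
rewrite -occurs_at_take ?leq_pred //.
exact/occurs_at_iso/order_iso_sym/std_word_iso.
Qed.

Lemma occurs_at_del_both p i : 1 < size tau ->
  occurs_at (del_both tau) p i =
    (i.+1 + size p <= (size tau).-1) && occurs_at tau p i.+1.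
Proof.
move=> tau1; rewrite -occurs_at_take ?leq_pred // -occurs_at_behead.
  exact/occurs_at_iso/order_iso_sym/std_word_iso.
by rewrite size_takel; lia.
Qed.

Lemma size_del_first : size (del_first tau) = (size tau).-1.
Proof. by rewrite /= size_std_word size_behead. Qed.

Lemma size_del_last : size (del_last tau) = (size tau).-1.
Proof. by rewrite /= size_std_word size_takel // leq_pred. Qed.

Hypothesis tau1 : 1 < size tau.

Let tau0 : 0 < size tau. Proof. exact: ltnW. Qed.

Lemma del_first_lt : (del_first tau < tau)%O.
Proof.
rewrite lt_neqAle; apply/andP; split.
  apply/eqP => /(congr1 (fun p : permutation => size p)).
  by rewrite size_del_first; lia.
apply/pattern_occursP; exists 1.
rewrite -occurs_at_del_first // /occurs_at add0n leqnn /factor drop0 take_size.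
exact: order_iso_refl.
Qed.

Lemma del_last_lt : (del_last tau < tau)%O.
Proof.
rewrite lt_neqAle; apply/andP; split.
  apply/eqP => /(congr1 (fun p : permutation => size p)).
  by rewrite size_del_last; lia.
apply/pattern_occursP; exists 0.
have : occurs_at (del_last tau) (del_last tau) 0.
  rewrite /occurs_at add0n leqnn /factor drop0 take_size.
  exact: order_iso_refl.
by rewrite occurs_at_del_last => /andP[].
Qed.

(** A proper pattern occurring at 0 misses the last letter of [tau]; one occurring later misses the
    first. *)
Lemma pattern_ltE p :
  (p < tau)%O = (p <= del_first tau)%O || (p <= del_last tau)%O.
Proof.
apply/idP/idP => [lt|/orP[] le]; last 2 first.
- exact: le_lt_trans le del_first_lt.
- exact: le_lt_trans le del_last_lt.
have sz := pattern_lt_size lt.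
have /pattern_occursP[[|i] occ] := ltW lt.
  apply/orP; right; apply/pattern_occursP; exists 0.
  by rewrite occurs_at_del_last occ andbT; lia.
by apply/orP; left; apply/pattern_occursP; exists i; rewrite occurs_at_del_first.
Qed.

Lemma del_both_le p : (p <= del_both tau)%O ->
  (p <= del_first tau)%O && (p <= del_last tau)%O.
Proof.
move=> /pattern_occursP[i]; rewrite occurs_at_del_both // => /andP[le occ].
apply/andP; split; apply/pattern_occursP.
  by exists i; rewrite occurs_at_del_first.
by exists i.+1; rewrite occurs_at_del_last le.
Qed.

(** An occurrence touching neither end of [tau] would survive both deletions. *)
Lemma pattern_nle_del_both p i : ~~ (p <= del_both tau)%O ->
  occurs_at tau p i -> i = 0 \/ i + size p = size tau.
Proof.
move=> nle occ; case: i occ => [|i] occ; first by left.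
right; apply/eqP; apply: contraNT nle => neq.
apply/pattern_occursP; exists i; rewrite occurs_at_del_both // occ andbT.
by case/andP: occ; move: neq; lia.
Qed.

(** The occurrence inherited from [del_last tau] misses the right end, so it is a prefix; the one
    from [del_first tau] misses the left end, so it is a suffix. *)
Lemma carrier_ends sigma xi : carrier sigma tau xi ->
  [/\ (size xi).+1 < size tau, occurs_at tau xi 0
    & occurs_at tau xi (size tau - size xi)].
Proof.
case/and4P => _ lt1 lt2 nle.
have sz := pattern_lt_size lt1; rewrite size_del_first in sz.
split; first by lia.
- have /pattern_occursP[i] := ltW lt2.
  rewrite occurs_at_del_last => /andP[le occ].
  by case: (pattern_nle_del_both nle occ) => E; [rewrite -E | lia].
- have /pattern_occursP[i] := ltW lt1.
  rewrite occurs_at_del_first // => occ.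
  case: (pattern_nle_del_both nle occ) => // E.
  by have -> : size tau - size xi = i.+1 by lia.
Qed.

Lemma carrier_unique sigma xi eta :
  carrier sigma tau xi -> carrier sigma tau eta -> xi = eta.
Proof.
wlog le : xi eta / size xi <= size eta => [hw|] cxi ceta.
  by case/orP: (leq_total (size xi) (size eta)) => h; [|symmetry]; apply: hw.
have [sx x0 xe] := carrier_ends cxi; have [se e0 ee] := carrier_ends ceta.
(* [xi] is a suffix of the suffix copy of [eta]; this moves it into the prefix copy. *)
have occ : occurs_at tau xi (0 + (size eta - size xi)).
  apply: (occurs_at_inside ee) e0; last by lia.
  by have -> : size tau - size eta + (size eta - size xi) =
    size tau - size xi by lia.
have nle : ~~ (xi <= del_both tau)%O by case/and4P: cxi.
have E := pattern_nle_del_both nle occ.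
(* In [E], offset 0 forces equal lengths; reaching the right end would give [eta] the length of
   [tau]. *)
by apply: (occurs_at_inj x0 e0); lia.
Qed.

(** If the deletions agree, the suffix occurrence of [xi] can be shifted one place left. It starts
    at 2 or later, so the shifted one touches neither end. *)
Lemma no_carrier_eq_del sigma xi :
  del_first tau = del_last tau -> ~~ carrier sigma tau xi.
Proof.
move=> eq_del; apply/negP => car.
have nle : ~~ (xi <= del_both tau)%O by case/and4P: car.
have [sz _ xe] := carrier_ends car.
have sE : size tau - size xi = (size tau - size xi).-1.+1 by lia.
move: xe; rewrite sE -occurs_at_del_first // eq_del occurs_at_del_last.
by move=> /andP[_ /(pattern_nle_del_both nle)]; lia.
Qed.

(** The deletions have equal length, so an element below both and equal to one would make them
    coincide; hence the strict inequalities can be relaxed. *)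
Lemma carrierE sigma xi : (sigma <= xi)%O -> del_first tau != del_last tau ->
  carrier sigma tau xi =
    [&& (xi <= del_first tau)%O, (xi <= del_last tau)%O
      & ~~ (xi <= del_both tau)%O].
Proof.
move=> le_sx neq; rewrite /carrier mem_pattern_interval le_sx /=.
apply/and4P/and3P => [[_ /ltW ? /ltW ?]//|[le1 le2 nle]].
split=> //; first exact: le_trans le1 (ltW del_first_lt).
- rewrite lt_neqAle le1 andbT; apply: contra_neq neq => E; subst xi.
  by apply: pattern_le_eq le2 _; rewrite size_del_first size_del_last.
- rewrite lt_neqAle le2 andbT; apply: contra_neq neq => E; subst xi.
  symmetry; apply: pattern_le_eq le1 _.
  by rewrite size_del_first size_del_last.
Qed.

End Deletions.

(** * Sums of the Möbius function *)

Local Open Scope ring_scope.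

(** Indexing by all patterns of [tau] lets sums for different [pi] be split and compared; the added
    terms, not above [sigma], are 0. *)
Lemma sum_mobius_le (sigma pi tau : permutation) :
  (sigma < pi)%O -> (pi <= tau)%O ->
  \sum_(rho <- patterns tau | (rho <= pi)%O) mobius sigma rho = 0.
Proof.
move=> lt le.
rewrite (bigID (fun rho => (sigma <= rho)%O)) /= [X in _ + X]big1 ?addr0; last first.
  by move=> rho /andP[_]; apply: mobius_nle.
rewrite -big_filter (perm_big (pattern_interval sigma pi)); last first.
  apply: uniq_perm => [||rho]; [|exact: pattern_interval_uniq|].
    by rewrite filter_uniq ?undup_uniq.
  rewrite mem_filter mem_pattern_interval mem_patterns.
  rewrite [(rho <= pi)%O && _]andbC; case: (boolP (rho <= pi)%O) => //= h.
    by rewrite (le_trans h le) andbT.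
  by rewrite !andbF.
rewrite (bigID (fun rho => (rho < pi)%O)) /=.
apply/eqP; rewrite addrC addr_eq0 -(mobius_lt lt) -big_filter.
rewrite (perm_big [:: pi]) ?big_seq1 //.
apply: uniq_perm => // [|rho]; first exact/filter_uniq/pattern_interval_uniq.
rewrite mem_filter mem_pattern_interval inE lt_neqAle negb_and negbK.
case: eqVneq => [->|_] /=; first by rewrite (ltW lt) lexx.
by case: (rho <= pi)%O; rewrite ?andbF.
Qed.

Lemma sum_mobius_lt (sigma tau : permutation) : (sigma < tau)%O ->
  mobius sigma tau =
    - \sum_(rho <- patterns tau | (rho < tau)%O) mobius sigma rho.
Proof.
move=> lt; rewrite mobius_lt // big_filter_cond; congr (- _).
rewrite [RHS](bigID (fun rho => (sigma <= rho)%O)) /= [X in _ + X]big1 ?addr0.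
  apply: eq_bigl => rho; rewrite andbC.
  by case: (boolP (rho < tau)%O) => //= /ltW ->; rewrite andbT.
by move=> rho /andP[_]; apply: mobius_nle.
Qed.

Lemma mobius_sum_carrier (sigma tau : permutation) :
  (1 < size tau)%N -> (sigma < del_both tau)%O ->
  mobius sigma tau =
    \sum_(rho <- patterns tau | carrier sigma tau rho) mobius sigma rho.
Proof.
move=> tau1 lt_b.
have /andP[le_bf le_bl] := del_both_le tau1 (lexx (del_both tau)).
have le_f := ltW (del_first_lt tau1); have le_l := ltW (del_last_lt tau1).
have lt_f := lt_le_trans lt_b le_bf; have lt_l := lt_le_trans lt_b le_bl.
have lt_t := lt_le_trans lt_f le_f.
rewrite sum_mobius_lt //.
rewrite (eq_bigl _ _ (pattern_ltE tau1)).
have [eq_del|neq_del] := eqVneq (del_first tau) (del_last tau).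
  rewrite [RHS]big1 => [|rho car]; last first.
    by have := no_carrier_eq_del tau1 sigma rho eq_del; rewrite car.
  under eq_bigl do rewrite eq_del orbb.
  by rewrite sum_mobius_le ?oppr0.
(* The part below [del_first tau] sums to 0, leaving the elements below [del_last tau] only. *)
rewrite (bigID (fun rho => (rho <= del_first tau)%O)) /=.
under eq_bigl do rewrite orbK.
rewrite sum_mobius_le // add0r.
(* Splitting this zero sum shows that the remaining part is minus the sum over elements below both
   deletions but not below [del_both tau]. *)
have := sum_mobius_le lt_l le_l.
rewrite (bigID (fun rho => (rho <= del_first tau)%O)) /=.
rewrite (bigID (fun rho => (rho <= del_both tau)%O)) /=.
rewrite (eq_bigl (fun rho => (rho <= del_both tau)%O)); last first.
  move=> rho; case: (boolP (rho <= del_both tau)%O); rewrite ?andbF //.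
  by move=> /(del_both_le tau1)/andP[-> ->].
rewrite sum_mobius_le //; last exact: le_trans le_bf le_f.
rewrite add0r => /eqP; rewrite addr_eq0 => /eqP sum0.
rewrite (eq_bigl (fun rho => (rho <= del_last tau)%O &&
    ~~ (rho <= del_first tau)%O)); last first.
  by move=> rho; case: (rho <= del_first tau)%O; rewrite ?andbF.
(* Above [sigma] these elements are exactly the carriers; elsewhere the terms are 0. *)
rewrite -sum0 (bigID (fun rho => (sigma <= rho)%O)) /= [X in _ + X]big1 ?addr0.
  apply: eq_bigl => rho; have [le|nle] := boolP (sigma <= rho)%O.
    by rewrite (carrierE tau1 le neq_del) andbT -andbA [RHS]andbCA.
  by rewrite andbF /carrier mem_pattern_interval (negbTE nle).
by move=> rho /andP[_]; apply: mobius_nle.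
Qed.

Local Close Scope ring_scope.

Theorem theorem3p5 (sigma tau : permutation) :
  2 <= #|occurrences sigma tau| ->
  3 <= size tau - size sigma ->
  del_both tau \in pattern_interval sigma tau ->
  (~ (exists xi : permutation, carrier sigma tau xi) ->
     mobius sigma tau = 0%R) /\
  (forall xi : permutation, carrier sigma tau xi ->
     mobius sigma tau = mobius sigma xi).
Proof.
move=> _ sz; rewrite mem_pattern_interval => /andP[le_sb _].
have tau1 : 1 < size tau by lia.
(* Two letters are deleted while the lengths differ by at least 3, so the inequality is strict. *)
have lt_sb : (sigma < del_both tau)%O.
  rewrite lt_neqAle le_sb andbT; apply/eqP.
  move=> /(congr1 (fun p : permutation => size p)) /=.
  by rewrite size_std_word size_behead size_takel ?leq_pred //; lia.
rewrite mobius_sum_carrier //; split=> [nocar|xi car].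
  by rewrite big1 // => rho car; case: nocar; exists rho.
rewrite -big_filter (perm_big [:: xi]) ?big_seq1 //.
apply: uniq_perm => // [|rho]; first by rewrite filter_uniq ?undup_uniq.
rewrite mem_filter inE mem_patterns; apply/andP/eqP => [[crho _]|->].
  exact: (carrier_unique tau1 crho car).
split=> //; case/and4P: car; rewrite mem_pattern_interval.
by case/andP.
Qed.
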